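(* The multiplication on $\mathbb{E}=S/B$ induced by composition of almost homomorphisms, $[f][g]=[f\circ g]$, makes the abelian group $\mathbb{E}$ into a commutative ring with unit.
   Context: A function $f:\mathbb{Z}\to\mathbb{Z}$ is an almost homomorphism iff the function $d_f(p,q)=f(p+q)-f(p)-f(q)$ from $\mathbb{Z}\times\mathbb{Z}$ to $\mathbb{Z}$ has bounded range, i.e. for some integer $C$, $|d_f(p,q)|<C$ for all $p,q\in\mathbb{Z}$. $S$ is the abelian group of all almost homomorphisms $\mathbb{Z}\to\mathbb{Z}$ under pointwise addition, and $B$ is the subgroup of all functions $\mathbb{Z}\to\mathbb{Z}$ with bounded range. The abelian group of Eudoxus reals is the quotient $\mathbb{E}=S/B$; $[f]$ denotes the class of $f\in S$. The product is $[f][g]=[p\mapsto f(g(p))]$, which is well defined: $f\circ g$ is an almost homomorphism if $f$ and $g$ are, and $[f\circ g]$ is independent of the choice of representatives $f$ and $g$. The unit is the class of the identity function $p\mapsto p$. *)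

(* Defs.v *)
From HB Require Import structures.
From mathcomp Require Import all_boot all_order all_algebra.
From mathcomp Require Import ring_quotient lra.
From mathcomp Require Import boolp functions.

Set Implicit Arguments.
Unset Strict Implicit.
Unset Printing Implicit Defensive.

Import Order.TTheory GRing.Theory Num.Theory.
Local Open Scope ring_scope.
Local Open Scope quotient_scope.

Definition bounded_range (T : Type) (f : T -> int) : Prop :=
  exists C : int, forall x : T, `|f x| < C.

Definition defect (f : int -> int) (pq : int * int) : int :=
  f (pq.1 + pq.2) - f pq.1 - f pq.2.

(* [int -> int] carries the pointwise group structure; [`[< P >]] turns the
   proposition [P] into a boolean, so that the library's closed predicates,
   subtypes and quotients apply. *)
Definition almost_hom : {pred int -> int} :=
  fun f => `[< bounded_range (defect f) >].

Lemma bounded_rangeB (T : Type) (f g : T -> int) :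
  bounded_range f -> bounded_range g -> bounded_range (fun x => f x - g x).
Proof.
move=> [C fC] [D gD]; exists (C + D) => x.
by apply: (le_lt_trans (ler_normB _ _)); apply: ltrD.
Qed.

Lemma almost_hom_zmod_closed : zmod_closed almost_hom.
Proof.
split=> [|f g /asboolP fS /asboolP gS]; apply/asboolP.
  by exists 1 => x; rewrite /defect !subr0 normr0.
have [C dC] := bounded_rangeB fS gS; exists C => x.
suff -> : defect (f - g) x = defect f x - defect g x by exact: dC.
by rewrite /defect !fctE; lra.
Qed.

HB.instance Definition _ :=
  GRing.isZmodClosed.Build (int -> int) almost_hom almost_hom_zmod_closed.

Record ahom := AlmostHom { ahfun :> int -> int; ahfunP : ahfun \in almost_hom }.

HB.instance Definition _ := [isSub for ahfun].
HB.instance Definition _ := [Choice of ahom by <:].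
HB.instance Definition _ := [SubChoice_isSubZmodule of ahom by <:].

(* Every function with bounded range is an almost homomorphism, so restricting
   to [ahom] loses nothing. *)
Lemma bounded_range_almost_hom (f : int -> int) :
  bounded_range f -> f \in almost_hom.
Proof.
move=> [C fC]; apply/asboolP; exists (C + C + C) => x.
apply: (le_lt_trans (ler_normB _ _)); apply: ltrD; last exact: fC.
by apply: (le_lt_trans (ler_normB _ _)); apply: ltrD.
Qed.

Definition bounded_ahom : {pred ahom} := fun f => `[< bounded_range f >].

Lemma bounded_ahom_zmod_closed : zmod_closed bounded_ahom.
Proof.
split=> [|f g /asboolP fB /asboolP gB]; apply/asboolP.
  by exists 1 => x; rewrite /= normr0.
exact: bounded_rangeB.
Qed.

HB.instance Definition _ :=
  GRing.isZmodClosed.Build ahom bounded_ahom bounded_ahom_zmod_closed.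

Definition eudoxus : zmodType := Quotient.quot bounded_ahom.

Definition eclass (f : ahom) : eudoxus := \pi_(Quotient.quot bounded_ahom) f.

Lemma ahom_linear_growth (f : int -> int) : f \in almost_hom ->
  exists K L : int, 0 <= K /\ forall n : int, `|f n| <= K * `|n| + L.
Proof.
move=> /asboolP[C dC].
have step n : `|f (n + 1) - f n - f 1| < C by exact: (dC (n, 1)).
have C0 : 0 <= C by apply: le_trans (normr_ge0 _) (ltW (step 0)).
exists (C + `|f 1|), `|f 0|; split; first exact: addr_ge0.
have stepK n : `|f (n + 1) - f n| <= C + `|f 1|.
  rewrite -(subrK (f 1) (f (n + 1) - f n)).
  by apply: (le_trans (ler_normD _ _)); rewrite lerD2r ltW.
have normS (n : nat) : `|n%:Z + 1| = `|n%:Z| + 1 :> int by rewrite !ger0_norm.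
have succ (n : nat) : n.+1%:Z = n%:Z + 1 by rewrite -addn1 PoszD.
elim=> [|n IH|n]; first by rewrite normr0 mulr0 add0r.
- rewrite succ normS mulrDr mulr1 -(subrK (f n%:Z) (f (n%:Z + 1))).
  have := ler_normD (f (n%:Z + 1) - f n%:Z) (f n%:Z).
  by have := stepK n%:Z; lra.
- rewrite succ !normrN normS mulrDr mulr1 => IH.
  have := stepK (- (n%:Z + 1)).
  rewrite opprD subrK distrC => st.
  rewrite -(subrK (f (- n%:Z)) (f (- n%:Z - 1))).
  have := ler_normD (f (- n%:Z - 1) - f (- n%:Z)) (f (- n%:Z)).
  by lra.
Qed.

Lemma almost_hom_comp (f g : int -> int) :
  f \in almost_hom -> g \in almost_hom -> f \o g \in almost_hom.
Proof.
move=> fS; have [K [L [K0 fKL]]] := ahom_linear_growth fS.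
move: fS => /asboolP[C fC] /asboolP[D gD].
apply/asboolP; exists (C + C + (K * D + L)) => -[p q]; rewrite /defect /=.
pose d := defect g (p, q).
have -> : g (p + q) = g p + g q + d by rewrite /d /defect /=; lra.
have -> : f (g p + g q + d) - f (g p) - f (g q) =
    defect f (g p + g q, d) + defect f (g p, g q) + f d.
  by rewrite /defect /=; lra.
apply: (le_lt_trans (ler_normD _ _)); apply: ltr_leD.
  by apply: (le_lt_trans (ler_normD _ _)); apply: ltrD; exact: fC.
by apply: (le_trans (fKL d)); rewrite lerD2r ler_wpM2l // ltW // gD.
Qed.

Definition ahcomp (f g : ahom) : ahom :=
  AlmostHom (almost_hom_comp (ahfunP f) (ahfunP g)).

Lemma almost_hom_id : idfun \in almost_hom.
Proof.
by apply/asboolP; exists 1 => x; rewrite /defect /= -addrA -opprD subrr normr0.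
Qed.

Definition ahid : ahom := AlmostHom almost_hom_id.

(* The library's record of a unit, a product and the axioms (associativity,
   commutativity, left unit, left distributivity over the given [+%R]) which
   extend the abelian group [eudoxus] to a [comPzRingType], i.e. a commutative
   ring with unit in which 1 <> 0 is not required. *)
Definition eudoxus_comring : Type := GRing.Zmodule_isComPzRing eudoxus.

Definition comring_one (M : eudoxus_comring) : eudoxus :=
  GRing.Zmodule_isComPzRing.one M.

Definition comring_mul (M : eudoxus_comring) : eudoxus -> eudoxus -> eudoxus :=
  GRing.Zmodule_isComPzRing.mul M.

(* Main.v *)
Require Import Defs.
From mathcomp Require Import all_boot all_order all_algebra.
From mathcomp Require Import ring_quotient lra.
From mathcomp Require Import boolp.

(** The proof rests on commutativity up to a bounded error, [ahcomp_comm].  An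
    almost homomorphism [f] is nearly homogeneous: [f (p * q) - p * f q] changes
    by a bounded amount when [p] moves by one, so it is at most linear in [p].
    By symmetry, [p * f q - q * f p] is at most linear in [p] and [q] together
    ([ahom_cross]).  Taking [q := g p] compares [p * f (g p)] with [g p * f p];
    exchanging [f] and [g] compares [p * g (f p)] with the same product.  Hence
    [p * (f (g p) - g (f p))] is at most linear in [p], and dividing by [p]
    bounds the difference of the two composites.

    The rest is formal.  Composition on the right respects sums exactly, so
    [f \o g] changes by a bounded function when [f] does; commutativity carries
    this over to [g], so the product is well defined on classes.
    Associativity, the unit law and left distributivity already hold for the
    functions themselves, and right distributivity follows by commutativity. *)

Local Open Scope ring_scope.
Local Open Scope quotient_scope.
Import Order.TTheory GRing.Theory Num.Theory.

(** For a fixed [q] this is used on [n |-> f (n * q) - n * f q], whose increments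
    are the defects of [f] at [(n * q, q)]; their bound is uniform in [q]. *)
Lemma bounded_steps_linear_growth (h : int -> int) (K : int) :
  (forall n, `|h (n + 1) - h n| <= K) ->
  forall n, `|h n| <= K * `|n| + `|h 0|.
Proof.
move=> stepK.
have normS (n : nat) : `|n%:Z + 1| = `|n%:Z| + 1 :> int by rewrite !ger0_norm.
have succ (n : nat) : n.+1%:Z = n%:Z + 1 by rewrite -addn1 PoszD.
elim=> [|n IH|n IH]; first by rewrite normr0 mulr0 add0r.
- rewrite succ normS mulrDr mulr1.
  have := ler_distD (h n%:Z) (h (n%:Z + 1)) 0; rewrite !subr0.
  by have := stepK n%:Z; lra.
- move: IH; rewrite succ !normrN normS mulrDr mulr1 => IH.
  have := stepK (- (n%:Z + 1)).
  rewrite opprD subrK distrC => st.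
  have := ler_distD (h (- n%:Z)) (h (- n%:Z - 1)) 0; rewrite !subr0.
  by lra.
Qed.

(** This bound replaces the exact identity [p * f q = q * f p] of additive
    maps: both sides are compared with [f (p * q)]. *)
Lemma ahom_cross (f : ahom) : exists C : int, 0 <= C /\
  forall p q : int, `|p * f q - q * f p| <= C * (`|p| + `|q| + 1).
Proof.
have [C dC] := asboolW (ahfunP f).
have C0 : 0 <= C by apply: le_trans (normr_ge0 _) (ltW (dC (0, 0))).
have near p q : `|f (p * q) - p * f q| <= C * `|p| + `|f 0|.
  have := @bounded_steps_linear_growth (fun n => f (n * q) - n * f q) C _ p.
  rewrite !mul0r subr0; apply=> n.
  suff -> : f ((n + 1) * q) - (n + 1) * f q - (f (n * q) - n * f q) =
      defect f (n * q, q) by exact/ltW/dC.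
  by rewrite /defect /= !mulrDl !mul1r; lra.
exists (C + (`|f 0| + `|f 0|)); split=> [|p q]; first by rewrite !addr_ge0.
have := ler_distD (f (p * q)) (p * f q) (q * f p).
rewrite [X in _ <= X + _]distrC.
have := near p q; have := near q p; rewrite (mulrC q p).
have F0 := normr_ge0 (f 0).
have := mulr_ge0 F0 (normr_ge0 p); have := mulr_ge0 F0 (normr_ge0 q).
by rewrite !(mulrDl, mulrDr); lra.
Qed.

Lemma ahcomp_comm (f g : ahom) :
  bounded_range (fun p => f (g p) - g (f p)).
Proof.
have [C [C0 fC]] := ahom_cross f; have [D [D0 gD]] := ahom_cross g.
have [K [L [K0 fKL]]] := ahom_linear_growth (ahfunP f).
have [M [N [M0 gMN]]] := ahom_linear_growth (ahfunP g).
have L0 : 0 <= L by have := fKL 0; rewrite normr0 mulr0 add0r; apply: le_trans.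
have N0 : 0 <= N by have := gMN 0; rewrite normr0 mulr0 add0r; apply: le_trans.
pose A := C * (1 + M + N + 1) + D * (1 + K + L + 1).
have A0 : 0 <= A by rewrite addr_ge0 // mulr_ge0 // !addr_ge0.
(* Division by [p] leaves out [p = 0], whose value is added to the bound. *)
exists (A + `|f (g 0) - g (f 0)| + 1) => p; rewrite ltzD1.
have [->|p0] := eqVneq p 0; first by rewrite lerDr.
apply: (@le_trans _ _ A); last by rewrite lerDl.
have p1 : 1 <= `|p| by rewrite -gtz0_ge1 normr_gt0.
(* As [1 <= `|p|], constant terms are absorbed into multiples of [`|p|]. *)
have linear (E a b : int) (h : int -> int) : 0 <= E -> 0 <= b ->
    `|h p| <= a * `|p| + b ->
    E * (`|p| + `|h p| + 1) <= `|p| * (E * (1 + a + b + 1)).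
  move=> E0 b0 hp; rewrite mulrCA ler_wpM2l //.
  by have := ler_wpM2l b0 p1; lra.
rewrite -(ler_pM2l (lt_le_trans ltr01 p1)) -normrM mulrBr [_ * A]mulrDr.
apply: le_trans (ler_distD (g p * f p) _ _) _; apply: lerD.
  exact: le_trans (fC p (g p)) (linear _ _ _ _ C0 N0 (gMN p)).
rewrite distrC [g p * _]mulrC.
exact: le_trans (gD p (f p)) (linear _ _ _ _ D0 L0 (fKL p)).
Qed.

Lemma eclass_eqP (f g : ahom) :
  bounded_range (fun p => f p - g p) <-> eclass f = eclass g.
Proof.
rewrite /eclass; split=> [fg|/eqP].
  by apply/eqP; rewrite -Quotient.idealrBE; apply/asboolP.
by rewrite -Quotient.idealrBE => /asboolP.
Qed.

Lemma eclassD (f g : ahom) : eclass (f + g) = eclass f + eclass g.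
Proof. by rewrite /eclass raddfD. Qed.

Lemma eclass_ahcompC (f g : ahom) : eclass (ahcomp f g) = eclass (ahcomp g f).
Proof. exact/eclass_eqP/ahcomp_comm. Qed.

Lemma eclass_ahcompl (f f' g : ahom) :
  eclass f = eclass f' -> eclass (ahcomp f g) = eclass (ahcomp f' g).
Proof.
move=> /eclass_eqP[C fC]; apply/eclass_eqP; exists C => p; exact: fC.
Qed.

Lemma eclass_repr (x : eudoxus) : eclass (repr x) = x.
Proof. exact: reprK. Qed.

Definition emul (x y : eudoxus) : eudoxus :=
  eclass (ahcomp (repr x) (repr y)).

(** Independence of the second representative is reduced to the first one by
    commutativity, which spares an estimate for [f (g p) - f (g' p)]. *)
Lemma emulE (f g : ahom) : emul (eclass f) (eclass g) = eclass (ahcomp f g).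
Proof.
apply: (etrans (eclass_ahcompl _ _ _ (eclass_repr (eclass f)))).
apply: (etrans (eclass_ahcompC _ _)).
apply: (etrans (eclass_ahcompl _ _ _ (eclass_repr (eclass g)))).
exact: eclass_ahcompC.
Qed.

Lemma eclass_surj (x : eudoxus) : exists f, x = eclass f.
Proof. by exists (repr x); rewrite eclass_repr. Qed.

Lemma emulA : associative emul.
Proof.
move=> x y z; have [f ->] := eclass_surj x; have [g ->] := eclass_surj y.
have [h ->] := eclass_surj z; rewrite !emulE; congr eclass; exact: val_inj.
Qed.

Lemma emulC : commutative emul.
Proof.
move=> x y; have [f ->] := eclass_surj x; have [g ->] := eclass_surj y.
by rewrite !emulE eclass_ahcompC.
Qed.

Lemma emul1 : left_id (eclass ahid) emul.
Proof.
move=> x; have [f ->] := eclass_surj x.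
rewrite emulE; congr eclass; exact: val_inj.
Qed.

Lemma emulDl : left_distributive emul +%R.
Proof.
move=> x y z; have [f ->] := eclass_surj x; have [g ->] := eclass_surj y.
have [h ->] := eclass_surj z; rewrite -eclassD !emulE -eclassD.
congr eclass; exact: val_inj.
Qed.

Theorem theorem9 :
  exists M : eudoxus_comring,
    comring_one M = eclass ahid /\
    (forall f g : ahom, comring_mul M (eclass f) (eclass g) = eclass (ahcomp f g)).
Proof.
exists (GRing.Zmodule_isComPzRing.Build eudoxus emulA emulC emul1 emulDl).
by split=> // f g; exact: emulE.
Qed.
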